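(* Let $r<w$ be positive reals. Every deterministic online algorithm (with no restriction on memory) for the $(n,k,r,w)$-Parity for Number of Hats problem is (no better than) $(w/r)$-competitive: there is a feasible input on which the cost of its output is $w$.
   Context: An online algorithm must produce its answer $y_i$ to request $x_i$ from $x_1,\dots,x_i$ (and earlier answers) only; it is $c$-competitive if there is $\alpha\ge 0$ with $cost(A(I))\le c\cdot cost(Opt(I))+\alpha$ for all inputs $I$, $Opt$ an optimal offline algorithm. For $X\in\{0,1\}^m$ with $\#_1(X)=v\cdot 2^k$, $v$ an integer, $PartialMOD_m^k(X)=v\bmod 2$. The $(n,k,r,w)$-Parity for Number of Hats problem: feasible inputs are $I=(2,X_1,2,X_2,2,X_3)$ of length $n=m_1+m_2+m_3+3$, with $m_i\ge 2^{k+1}$, $X_i\in\{0,1\}^{m_i}$, $\#_1(X_i)$ a multiple of $2^k$. Let $y_1,y_2,y_3$ be the output bits at the three requests with value $2$ and $z_j=\bigoplus_{i=j}^{3}PartialMOD_{m_i}^k(X_i)$. The cost is $r$ if $y_j=z_j$ for all $j$, and $w$ otherwise, with $r<w$.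
   Formalization: ''No better than (w/r)-competitive'' is proved with additive constant α = 0, since costs never exceed w and with α = w every algorithm would be 0-competitive; n is taken large enough, n ≥ 3·2^(k+1)+3, for feasible inputs to exist. *)

(* Defs.v *)
From HB Require Import structures.
From mathcomp Require Import all_boot all_order all_algebra.
From mathcomp Require Import reals.

Set Implicit Arguments.
Unset Strict Implicit.
Unset Printing Implicit Defensive.
Import Order.TTheory GRing.Theory Num.Theory.

(* A deterministic online algorithm with unrestricted memory: the answer y_i
   is a function of the requests x_1, ..., x_i and the answers
   y_1, ..., y_(i-1). *)
Definition online_algorithm (S O : Type) := seq S -> seq O -> O.

Fixpoint answers_from (S O : Type) (A : online_algorithm S O)
    (past : seq S) (given : seq O) (future : seq S) : seq O :=
  if future is x :: future' then
    let past' := rcons past x in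
    answers_from A past' (rcons given (A past' given)) future'
  else given.

Definition answers (S O : Type) (A : online_algorithm S O) (xs : seq S) :
  seq O := answers_from A [::] [::] xs.

Definition request := 'I_3.
Definition two : request := ord_max.
Definition bit (b : bool) : request := inord b.

(* v mod 2 (as a bit), where #_1(X) = v * 2 ^ k; only meaningful when 2 ^ k
   divides #_1(X). *)
Definition PartialMOD (k : nat) (X : seq bool) : bool :=
  odd (count_mem true X %/ 2 ^ k).

(* The triple of blocks (X_1, X_2, X_3), indexed from 0, stands for the
   request sequence 2, X_1, 2, X_2, 2, X_3, from which it can be recovered. *)
Definition hats_input := 3.-tuple (seq bool).

Definition requests (I : hats_input) : seq request :=
  flatten [seq two :: map bit X | X <- I].

Definition feasible (n k : nat) (I : hats_input) : Prop :=
  size (requests I) = n /\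
  forall i : 'I_3, 2 ^ k.+1 <= size (tnth I i) /\
                   2 ^ k %| count_mem true (tnth I i).

Definition hat_outputs (I : hats_input) (y : seq bool) : seq bool :=
  mask [seq x == two | x <- requests I] y.

Definition hat_parity (k : nat) (I : hats_input) (j : 'I_3) : bool :=
  \big[addb/false]_(i < 3 | j <= i) PartialMOD k (tnth I i).

Local Open Scope ring_scope.

Definition hats_cost (R : realType) (k : nat) (r w : R)
    (I : hats_input) (y : seq bool) : R :=
  if hat_outputs I y == [seq hat_parity k I j | j <- enum 'I_3] then r else w.

Definition optimal_offline (R : realType) (n k : nat) (r w : R)
    (Opt : hats_input -> seq bool) : Prop :=
  forall I, feasible n k I ->
    size (Opt I) = n /\
    forall y : seq bool, size y = n ->
      hats_cost k r w I (Opt I) <= hats_cost k r w I y.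

Definition competitive_with (R : realType) (n k : nat) (r w : R)
    (Opt : hats_input -> seq bool) (A : online_algorithm request bool)
    (c alpha : R) : Prop :=
  forall I, feasible n k I ->
    hats_cost k r w I (answers A (requests I)) <=
    c * hats_cost k r w I (Opt I) + alpha.

Definition competitive (R : realType) (n k : nat) (r w : R)
    (Opt : hats_input -> seq bool) (A : online_algorithm request bool)
    (c : R) : Prop :=
  exists2 alpha : R, 0 <= alpha & competitive_with n k r w Opt A c alpha.

(* For a fixed n the cost is bounded by w, so that a lower bound on c is only
   meaningful with additive constant 0. *)
Definition strictly_competitive (R : realType) (n k : nat) (r w : R)
    (Opt : hats_input -> seq bool) (A : online_algorithm request bool)
    (c : R) : Prop :=
  competitive_with n k r w Opt A c 0.

(* Main.v *)
(* The answer at the first request is fixed before any bit is revealed, whereas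
   z_1 depends on all three blocks. Take X_1 and X_2 zero, and X_3 with 0 or
   2^k ones: this makes z_1 equal to 0 or 1, and one of the two choices differs
   from the first answer. *)
Require Import Defs.
From HB Require Import structures.
From mathcomp Require Import all_boot all_order all_algebra.
From mathcomp Require Import reals.
Import Order.TTheory GRing.Theory Num.Theory.
Local Open Scope ring_scope.

(** Each step only appends to the accumulator [given], so an answer once given is never revised. *)
Lemma answers_from_cat (S O : Type) (A : online_algorithm S O) past given xs :
  exists t, answers_from A past given xs = given ++ t.
Proof.
elim: xs past given => [|x xs IH] past given /=.
  by exists [::]; rewrite cats0.
by have [t ->] := IH (rcons past x) (rcons given (A (rcons past x) given));
  exists (A (rcons past x) given :: t); rewrite cat_rcons.
Qed.

(** The selected positions can be filled freely; [x0] is the filler at all others. *)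
Lemma mask_surj (T : Type) (x0 : T) (m : bitseq) (s : seq T) :
  count_mem true m = size s -> exists2 y, size y = size m & mask m y = s.
Proof.
elim: m s => [|[] m IH] s /=; first by case: s => // _; exists [::].
  case: s => [|x s] //= [/IH [y sy my]].
  by exists (x :: y); rewrite /= ?sy ?my.
by move=> /IH [y sy my]; exists (x0 :: y); rewrite /= ?sy ?my.
Qed.

Lemma bit_neq_two (b : bool) : (bit b == two) = false.
Proof. by rewrite -val_eqE /= inordK //; case: b. Qed.

Lemma count_two_requests (I : hats_input) : count_mem two (requests I) = 3%N.
Proof.
have count_bits X : count_mem two (map bit X) = 0%N.
  rewrite count_map (eq_count (a2 := pred0)) ?count_pred0 // => b /=.
  exact: bit_neq_two.
case: I => -[|X [|Y [|Z []]]] // sI.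
by rewrite /requests /= cats0 !count_cat /= count_cat /= !count_bits.
Qed.

Lemma hat_outputs_surj (I : hats_input) (z : seq bool) : size z = 3%N ->
  exists2 y, size y = size (requests I) & hat_outputs I y = z.
Proof.
move=> sz; have [|y sy my] := @mask_surj _ false [seq x == two | x <- requests I] z.
  rewrite sz count_map -[RHS](count_two_requests I).
  by apply: eq_count => x /=; rewrite eqb_id.
by exists y; rewrite ?sy ?size_map.
Qed.

(** Some answer sequence puts the right parities at the three requests [two] and costs [r]; an
    optimum of cost [w] would contradict [r < w]. *)
Lemma optimal_offline_cost {R : realType} {n k : nat} {r w : R} {Opt} :
  r < w -> optimal_offline n k r w Opt ->
  forall I, feasible n k I -> hats_cost k r w I (Opt I) = r.
Proof.
move=> rw optP I fI; have [sI _] := fI; have [_ opt_le] := optP I fI.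
have [|y sy yz] := @hat_outputs_surj I [seq hat_parity k I j | j <- enum 'I_3].
  by rewrite size_map size_enum_ord.
have := opt_le y; rewrite sy => /(_ sI).
rewrite {2}/hats_cost yz eqxx /hats_cost; case: ifP => // _.
by rewrite leNgt rw.
Qed.

(** Every input opens with [two], so the first hat output is one bit common to all inputs. *)
Lemma hat_outputs_answers (A : online_algorithm request bool) (I : hats_input) :
  exists t, hat_outputs I (answers A (requests I)) = A [:: two] [::] :: t.
Proof.
case: I => -[|X Xs] // sI; rewrite /hat_outputs /requests /answers /=.
have [t ->] := answers_from_cat _ _ A [:: two] [:: A [:: two] [::]]
  (map bit X ++ flatten [seq two :: map bit Y | Y <- Xs]).
by eexists.
Qed.

Definition block (k m : nat) (b : bool) : seq bool :=
  nseq (b * 2 ^ k) true ++ nseq (m - b * 2 ^ k) false.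

Lemma size_block k m b : (2 ^ k.+1 <= m)%N -> size (block k m b) = m.
Proof.
move=> le_m; rewrite size_cat !size_nseq subnKC //.
by apply: leq_trans le_m; rewrite expnS leq_mul2r; case: b; rewrite orbT.
Qed.

Lemma count_block k m b : count_mem true (block k m b) = (b * 2 ^ k)%N.
Proof. by rewrite count_cat !count_nseq /= mul1n mul0n addn0. Qed.

Lemma PartialMOD_block k m b : PartialMOD k (block k m b) = b.
Proof. by rewrite /PartialMOD count_block mulnK ?expn_gt0 // oddb. Qed.

Lemma feasible_with_parity (n k : nat) (b : bool) :
  (3 * 2 ^ k.+1 + 3 <= n)%N ->
  exists2 I, feasible n k I & hat_parity k I ord0 = b.
Proof.
set p := (2 ^ k.+1)%N => le_n.
(* The length left for the third block after two blocks of minimal length [p] and the three requests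
   [two]. *)
pose q := (n - (2 * p + 3))%N.
have n_def : (q + (2 * p + 3))%N = n.
  by rewrite subnK //; apply: leq_trans le_n; rewrite leq_add2r leq_mul2r orbT.
have le_q : (p <= q)%N.
  by rewrite -(leq_add2r (2 * p + 3)) n_def addnA -mulSn.
exists [tuple block k p false; block k p false; block k q b].
  split.
    rewrite /requests /= cats0 !size_cat /= size_cat /= !size_map !size_block //.
    by rewrite -n_def !addnS addn0 mul2n -addnn addnA (addnC q).
  have block_ok m c : (p <= m)%N ->
      (p <= size (block k m c))%N /\ (2 ^ k %| count_mem true (block k m c))%N.
    by move=> le_m; rewrite size_block // count_block dvdn_mull.
  by case=> -[|[|[|]]] //= ?; apply: block_ok.
rewrite /hat_parity !big_ord_recl big_ord0 /= !(tnth_nth [::]) /=.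
by rewrite !PartialMOD_block addbF.
Qed.

Theorem theorem4 (R : realType) (n k : nat) (r w : R)
  (hr : 0 < r) (hrw : r < w)
  (hn : (3 * 2 ^ k.+1 + 3 <= n)%N)
  (Opt : hats_input -> seq bool) (hOpt : optimal_offline n k r w Opt)
  (A : online_algorithm request bool) :
  [/\ exists I : hats_input,
        [/\ feasible n k I,
            hats_cost k r w I (answers A (requests I)) = w
          & hats_cost k r w I (Opt I) = r],
      competitive n k r w Opt A (w / r)
    & forall c : R, strictly_competitive n k r w Opt A c -> w / r <= c].
Proof.
have optE := optimal_offline_cost hrw hOpt.
(* The adversary can negate the first answer, since that answer does not depend on [I]. *)
have [I fI zI] := feasible_with_parity n k (~~ A [:: two] [::]) hn.
have costI : hats_cost k r w I (answers A (requests I)) = w.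
  have [t yE] := hat_outputs_answers A I.
  (* The lists already differ at their heads, a bit and its negation. *)
  rewrite /hats_cost yE enum_ordSl /= eqseq_cons zI.
  by case: (A _ _).
split.
- by exists I; split=> //; apply: optE.
(* No additive constant is needed: the cost never exceeds [w], which is [w / r] times the optimum
   [r]. *)
- exists 0 => // J fJ.
  rewrite optE // addr0 divfK ?gt_eqF // /hats_cost.
  by case: ifP => // _; apply: ltW.
(* On the adversarial input the bound reads [w <= c * r]. *)
- by move=> c /(_ I fI); rewrite costI optE // addr0 ler_pdivrMr.
Qed.
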